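(* $\mathbf{MIN}=\mathbf{MIL}$: a formula of $\mathcal{L}$ is valid on all posets under the minimal-upper-bound semantics if and only if it is valid on all posets under the least-upper-bound (supremum) semantics.
   Context: The language $\mathcal{L}$ is given by $\varphi::=\bot\mid p\mid\neg\varphi\mid\varphi\lor\varphi\mid\Diamond\varphi\varphi$, with $p$ ranging over a set of propositional letters and $\Diamond$ a binary modality. A poset model is $(P,\leq,V)$ with $(P,\leq)$ a partial order and $V$ assigning to each propositional letter a subset of $P$. For $s,t,u\in P$: $s\in\mathrm{mub}\{t,u\}$ ($s$ is a minimal upper bound of $\{t,u\}$) iff $t\leq s$, $u\leq s$, and there is no upper bound $x$ of $\{t,u\}$ with $x<s$; $s=\sup\{t,u\}$ iff $s$ is an upper bound of $\{t,u\}$ and $s\leq x$ for every upper bound $x$ of $\{t,u\}$. Boolean connectives and $\bot$ are interpreted classically, $p$ by $V$. Under the minimal-upper-bound semantics $\Vdash_M$: $s\Vdash_M\Diamond\varphi\psi$ iff there are $t,u\in P$ with $t\Vdash_M\varphi$, $u\Vdash_M\psi$ and $s\in\mathrm{mub}\{t,u\}$. Under the supremum semantics $\Vdash_S$: $s\Vdash_S\Diamond\varphi\psi$ iff there are $t,u\in P$ with $t\Vdash_S\varphi$, $u\Vdash_S\psi$ and $s=\sup\{t,u\}$. A formula is valid on a frame if true at every point under every valuation. $\mathbf{MIN}$ is the set of formulas valid on all posets under $\Vdash_M$; $\mathbf{MIL}$ is the set of formulas valid on all posets under $\Vdash_S$. *)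

(* Defs.v *)
From Stdlib Require Import Relations.

Set Implicit Arguments.

(* A is the type of propositional letters. *)
Inductive form (A : Type) : Type :=
| Bot : form A
| Var : A -> form A
| Neg : form A -> form A
| Or : form A -> form A -> form A
| Dia : form A -> form A -> form A.

Arguments Bot {A}.

Record poset : Type := Poset {
  carrier :> Type;
  le : relation carrier;
  le_order : order carrier le
}.

Arguments le {p} _ _.

Section Bounds.

Variable P : poset.

Definition lt (x y : P) : Prop := le x y /\ x <> y.

Definition upper_bound (t u x : P) : Prop := le t x /\ le u x.

Definition mub (s t u : P) : Prop :=
  upper_bound t u s /\ ~ (exists x : P, upper_bound t u x /\ lt x s).

Definition is_sup (s t u : P) : Prop :=
  upper_bound t u s /\ forall x : P, upper_bound t u x -> le s x.

End Bounds.

Definition valuation (A : Type) (P : poset) : Type := A -> P -> Prop.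

(* The two semantics differ only in the ternary relation R interpreting Dia. *)
Fixpoint sat (A : Type) (P : poset) (R : P -> P -> P -> Prop)
    (V : valuation A P) (s : P) (phi : form A) : Prop :=
  match phi with
  | Bot => False
  | Var p => V p s
  | Neg psi => ~ sat R V s psi
  | Or psi chi => sat R V s psi \/ sat R V s chi
  | Dia psi chi =>
      exists t u : P, sat R V t psi /\ sat R V u chi /\ R s t u
  end.

Definition satM (A : Type) (P : poset) (V : valuation A P) (s : P)
    (phi : form A) : Prop := sat (@mub P) V s phi.

Definition satS (A : Type) (P : poset) (V : valuation A P) (s : P)
    (phi : form A) : Prop := sat (@is_sup P) V s phi.

Definition validM (A : Type) (P : poset) (phi : form A) : Prop :=
  forall (V : valuation A P) (s : P), satM V s phi.

Definition validS (A : Type) (P : poset) (phi : form A) : Prop :=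
  forall (V : valuation A P) (s : P), satS V s phi.

Definition MIN (A : Type) (phi : form A) : Prop :=
  forall P : poset, validM P phi.

Definition MIL (A : Type) (phi : form A) : Prop :=
  forall P : poset, validS P phi.

(* Main.v *)
From Stdlib Require Import Relations List Lia.
From Stdlib Require Import Classical FunctionalExtensionality PropExtensionality ProofIrrelevance.
Require Import Defs.
Import ListNotations.

(** Both [mub] and [is_sup] on a poset [F] are instances of a symmetric relation
    [R] bounded by the order and containing all [(s, s, t)] with [t <= s].  For
    every such [R] we build a poset [Q] of sets, ordered by inclusion, in which
    each set carries a label in [F], such that labelling is a bounded morphism
    onto [(F, R)] both for [mub] and for [is_sup] on [Q].

    A set labelled [c] is split, for every [R c a b], into a part labelled [a]
    and a part labelled [b] with union the given set, which is then their
    supremum.  The splits are made along independent sets, so that two sets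
    coming from different splits never have a union that belongs to [Q] (unless
    one contains the other, up to small sets).  Since [Q] is closed under
    removal of single elements, a minimal upper bound of two sets is their
    union, hence arises from one of the splits. *)

Section Unravelling.

Variable F : poset.
Variable R : F -> F -> F -> Prop.

Hypothesis R_sym : forall s t u, R s t u -> R s u t.
Hypothesis R_le : forall s t u, R s t u -> le t s.
Hypothesis R_refl : forall s t, le t s -> R s s t.

Let le_refl (x : F) : le x x := ord_refl _ _ (le_order F) x.
Let le_trans (x y z : F) : le x y -> le y z -> le x z := ord_trans _ _ (le_order F) x y z.
Let le_antisym (x y : F) : le x y -> le y x -> x = y := ord_antisym _ _ (le_order F) x y.

(** The number records the depth of the split, so that no token is used twice
    along a branch. *)
Definition token : Type := (F * F * F * nat)%type.

(** The sets [{l | In tau l}] are independent: every Boolean combination of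
    finitely many of them is nonempty. *)
Inductive core : (F -> list token -> Prop) -> F -> nat -> Prop :=
| core_root r : core (fun d _ => le d r) r 0
| core_left K c a b k : core K c k -> R c a b ->
    core (fun d l => K d l /\ (le d a \/ In (c, a, b, k) l)) a (S k)
| core_right K c a b k : core K c k -> R c a b ->
    core (fun d l => K d l /\ (le d b \/ ~ In (c, a, b, k) l)) b (S k).

(** * Fibres of cores and their unions *)

Lemma core_full K a k d l : core K a k -> le d a -> K d l.
Proof.
  intros H; revert d l.
  induction H as [r | K c a b k H IH Hr | K c a b k H IH Hr]; intros d l Hd; auto.
  - split; [apply IH; eapply le_trans; eauto | now left].
  - split; [apply IH; eapply le_trans; eauto | now left].
Qed.

(** Some list always violates the last splitting condition. With [core_full], the label is the
    greatest [d] whose fibre is full. *)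
Lemma core_full_le K a k d : core K a k -> (forall l, K d l) -> le d a.
Proof.
  intros [r | K' c a' b k' _ _ | K' c a' b k' _ _] H.
  - exact (H []).
  - destruct (H []) as [_ [? | []]]; auto.
  - destruct (H [(c, a', b, k')]) as [_ [? | n]]; auto.
    exfalso; apply n; now left.
Qed.

(** The token is fresh: the last split of [K], if any, used a smaller depth, so its condition can
    still fail on a list containing this token. *)
Lemma core_half_le K e a b k d :
  core K e k -> (forall l, In (e, a, b, k) l -> K d l) -> le d e.
Proof.
  intros H.
  inversion H as [r | K' c a' b' k' HK Hr | K' c a' b' k' HK Hr]; subst; intros h.
  - exact (h [(e, a, b, 0)] (or_introl eq_refl)).
  - destruct (h [(e, a, b, S k')] (or_introl eq_refl)) as [_ [? | [E | []]]]; auto.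
    injection E; intros; lia.
  - destruct (h [(e, a, b, S k'); (c, a', e, k')] (or_introl eq_refl)) as [_ [? | n]]; auto.
    exfalso; apply n; right; now left.
Qed.

(** [K1] and [K2] stand for the parents of opposite halves cut along one token: glued together, the
    halves fill the fibre of [K] over [e]. *)
Lemma core_split_eq K K1 K2 c e a b k m :
  core K c k -> core K1 e m -> core K2 e m ->
  (forall l, In (e, a, b, m) l -> K1 c l) ->
  (forall d l, K1 d l -> In (e, a, b, m) l -> K d l) ->
  (forall d l, K2 d l -> ~ In (e, a, b, m) l -> K d l) ->
  e = c.
Proof.
  intros H H1 H2 Hc S1 S2.
  apply le_antisym.
  - apply (core_full_le K c k e H); intros l.
    destruct (classic (In (e, a, b, m) l)) as [i | i].
    + apply S1; auto. exact (core_full K1 e m e l H1 (le_refl e)).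
    + apply S2; auto. exact (core_full K2 e m e l H2 (le_refl e)).
  - exact (core_half_le K1 e a b m c H1 Hc).
Qed.

(** Unless [c] is [a] or [b], two proper parts cover the full fibre over [c]. Independence makes
    them opposite halves for one token, and [core_split_eq] identifies the parent label with [c]. *)
Lemma core_union K K1 K2 c a b k k1 k2 :
  core K c k -> core K1 a k1 -> core K2 b k2 ->
  (forall d l, K1 d l -> K d l) -> (forall d l, K2 d l -> K d l) ->
  (forall d l, K d l -> K1 d l \/ K2 d l) ->
  R c a b.
Proof.
  intros H H1 H2 S1 S2 U.
  assert (Ha : le a c).
  { apply (core_full_le K c k a H); intros l. apply S1, (core_full K1 a k1); auto. }
  assert (Hb : le b c).
  { apply (core_full_le K c k b H); intros l. apply S2, (core_full K2 b k2); auto. }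
  destruct (classic (le c a)) as [ca | ca].
  { rewrite (le_antisym a c Ha ca). auto. }
  destruct (classic (le c b)) as [cb | cb].
  { rewrite (le_antisym b c Hb cb). auto. }
  assert (V : forall l, K1 c l \/ K2 c l).
  { intros l. apply U, (core_full K c k); auto. }
  inversion H1 as [r | J1 c1 a1 b1 m1 HJ1 R1 | J1 c1 a1 b1 m1 HJ1 R1]; subst.
  { exfalso; apply cb, (core_full_le K2 b k2 c H2). intros l; destruct (V l); tauto. }
  all: inversion H2 as [r | J2 c2 a2 b2 m2 HJ2 R2 | J2 c2 a2 b2 m2 HJ2 R2]; subst.
  all: cbv beta in *.
  1, 4: exfalso; apply ca, (core_full_le _ _ _ c H1); intros l; destruct (V l); tauto.
  - destruct (V []) as [[_ [? | []]] | [_ [? | []]]]; tauto.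
  (* This list fails the right-hand condition and meets the left-hand one only if the tokens
     coincide. *)
  - destruct (V [(c2, a2, b, m2)]) as [[_ [? | [E | []]]] | [_ [? | n]]]; try tauto.
    2: exfalso; apply n; now left.
    injection E; intros; subst c1 a2 b1 m1.
    rewrite <- (core_split_eq K J1 J2 c c2 a b k m2); auto.
    intros l i. destruct (V l); tauto.
  - destruct (V [(c1, a1, a, m1)]) as [[_ [? | n]] | [_ [? | [E | []]]]]; try tauto.
    1: exfalso; apply n; now left.
    injection E; intros; subst c1 a1 b2 m1.
    rewrite <- (core_split_eq K J2 J1 c c2 b a k m2); auto.
    intros l i. destruct (V l); tauto.
  - destruct (V [(c1, a1, a, m1); (c2, a2, b, m2)]) as [[_ [? | n]] | [_ [? | n]]]; try tauto.
    + exfalso; apply n; now left.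
    + exfalso; apply n; right; now left.
Qed.

(** The coordinate in [nat] provides infinitely many copies of each point
    [(d, l)]; a set of [Q] is a core up to finitely many layers. *)
Definition labelled (X : F -> list token -> nat -> Prop) (w : F) : Prop :=
  exists K k m, core K w k /\ forall d l n, m <= n -> (X d l n <-> K d l).

(** * Labelled sets *)

Lemma labelled_mono X Y a b :
  (forall d l n, X d l n -> Y d l n) -> labelled X a -> labelled Y b -> le a b.
Proof.
  intros S (K & k & m & HK & EK) (J & j & p & HJ & EJ).
  apply (core_full_le J b j a HJ); intros l.
  (* Layer [m + p] lies past both thresholds, where the sets agree with their cores. *)
  apply (EJ a l (m + p)); [lia |]. apply S. apply EK; [lia |].
  apply (core_full K a k); auto.
Qed.

Lemma labelled_remove X c d0 l0 n0 :
  labelled X c ->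
  labelled (fun d l n => X d l n /\ (d, l, n) <> (d0, l0, n0)) c.
Proof.
  intros (K & k & m & HK & EK).
  exists K, k, (m + S n0); split; auto.
  intros d l n Hn. rewrite <- (EK d l n) by lia.
  split; [tauto |]. intros x; split; auto.
  intros E; injection E; intros; lia.
Qed.

Lemma labelled_union X Y Z c a b :
  labelled X c -> labelled Y a -> labelled Z b ->
  (forall d l n, Y d l n -> X d l n) -> (forall d l n, Z d l n -> X d l n) ->
  (forall d l n, X d l n -> Y d l n \/ Z d l n) ->
  R c a b.
Proof.
  intros (K & k & m & HK & EK) (K1 & k1 & m1 & HK1 & EK1) (K2 & k2 & m2 & HK2 & EK2) S1 S2 U.
  set (N := m + m1 + m2).
  assert (E : forall d l, X d l N <-> K d l) by (intros; apply EK; lia).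
  assert (E1 : forall d l, Y d l N <-> K1 d l) by (intros; apply EK1; lia).
  assert (E2 : forall d l, Z d l N <-> K2 d l) by (intros; apply EK2; lia).
  apply (core_union K K1 K2 c a b k k1 k2); auto; intros d l.
  - rewrite <- E, <- E1; auto.
  - rewrite <- E, <- E2; auto.
  - rewrite <- E, <- E1, <- E2; auto.
Qed.

Lemma labelled_split X c a b :
  labelled X c -> R c a b ->
  exists Y Z, labelled Y a /\ labelled Z b /\
    forall d l n, X d l n <-> Y d l n \/ Z d l n.
Proof.
  intros (K & k & m & HK & EK) Hr.
  exists (fun d l n => X d l n /\ (le d a \/ In (c, a, b, k) l)),
         (fun d l n => X d l n /\ (le d b \/ ~ In (c, a, b, k) l)).
  repeat split.
  - eexists _, _, m; split; [exact (core_left K c a b k HK Hr) |].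
    intros d l n Hn; cbv beta. rewrite (EK d l n Hn). tauto.
  - eexists _, _, m; split; [exact (core_right K c a b k HK Hr) |].
    intros d l n Hn; cbv beta. rewrite (EK d l n Hn). tauto.
  - intros x. destruct (classic (In (c, a, b, k) l)); tauto.
  - tauto.
Qed.

(** * The poset [Q] and its labelling *)

Definition unravelled : Type :=
  {X : F -> list token -> nat -> Prop | exists w, labelled X w}.

Definition subset (X Y : unravelled) : Prop :=
  forall d l n, proj1_sig X d l n -> proj1_sig Y d l n.

Lemma subset_order : order unravelled subset.
Proof.
  split.
  - intros X d l n; auto.
  - intros X Y Z H1 H2 d l n; auto.
  - intros [X HX] [Y HY] H1 H2; unfold subset in *; simpl in *.
    assert (X = Y) as ->.
    { extensionality d; extensionality l; extensionality n.
      apply propositional_extensionality; split; auto. }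
    f_equal; apply proof_irrelevance.
Qed.

Definition Q : poset := Poset subset_order.

Definition point X w (H : labelled X w) : Q :=
  exist (fun X => exists w, labelled X w) X (ex_intro _ w H).

Definition label (X : Q) (w : F) : Prop := labelled (proj1_sig X) w.

Lemma label_unique (X : Q) v w : label X v -> label X w -> v = w.
Proof.
  intros H1 H2; apply le_antisym.
  - exact (labelled_mono _ _ v w (fun _ _ _ h => h) H1 H2).
  - exact (labelled_mono _ _ w v (fun _ _ _ h => h) H2 H1).
Qed.

Lemma label_surj w : exists X : Q, label X w.
Proof.
  assert (H : labelled (fun d _ _ => le d w) w).
  { eexists _, _, 0; split; [exact (core_root w) |]; tauto. }
  exists (point _ w H); exact H.
Qed.

Lemma label_forth (X Y Z : Q) c a b :
  label X c -> label Y a -> label Z b -> mub Q X Y Z -> R c a b.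
Proof.
  intros HX HY HZ [[SY SZ] Hmin].
  apply (labelled_union _ _ _ c a b HX HY HZ SY SZ).
  (* Deleting a point outside [Y] and [Z] would give a smaller upper bound. *)
  intros d l n x. apply NNPP; intros no. apply Hmin.
  pose proof (labelled_remove _ c d l n HX) as HX'.
  exists (point _ c HX'). split; [split | split].
  - intros d' l' n' y; split; [now apply SY |].
    intros E; injection E as -> -> ->. tauto.
  - intros d' l' n' z; split; [now apply SZ |].
    intros E; injection E as -> -> ->. tauto.
  - intros d' l' n' [h _]; exact h.
  - intros E; rewrite <- E in x; simpl in x. tauto.
Qed.

Lemma label_back (X : Q) c a b :
  label X c -> R c a b ->
  exists Y Z : Q, label Y a /\ label Z b /\ is_sup Q X Y Z.
Proof.
  intros HX Hr.
  destruct (labelled_split _ c a b HX Hr) as (Y & Z & HY & HZ & E).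
  exists (point Y a HY), (point Z b HZ).
  repeat split; auto.
  - intros d l n y; apply E; now left.
  - intros d l n z; apply E; now right.
  - intros W [SY SZ] d l n x. apply E in x as [y | z]; [now apply SY | now apply SZ].
Qed.

(** Letting [R'] range between [is_sup] and [mub] makes one induction serve both semantics on
    [Q]. *)
Lemma sat_label (A : Type) (V : valuation A F) (R' : Q -> Q -> Q -> Prop) :
  (forall X Y Z, R' X Y Z -> mub Q X Y Z) ->
  (forall X Y Z, is_sup Q X Y Z -> R' X Y Z) ->
  forall (phi : form A) (X : Q) (w : F), label X w ->
    (sat R' (fun p Y => exists v, label Y v /\ V p v) X phi <-> sat R V w phi).
Proof.
  intros Hmub Hsup phi.
  induction phi as [| p | psi IH | psi IH1 chi IH2 | psi IH1 chi IH2];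
    intros X w HX; simpl.
  - tauto.
  - split.
    + intros (v & Hv & Vv). now rewrite (label_unique X w v HX Hv).
    + intros Vw; exists w; auto.
  - rewrite (IH X w HX); tauto.
  - rewrite (IH1 X w HX), (IH2 X w HX); tauto.
  - split.
    + intros (Y & Z & sY & sZ & HR).
      destruct (proj2_sig Y) as [a HY]; destruct (proj2_sig Z) as [b HZ].
      exists a, b. split; [now apply (IH1 Y a HY) | split; [now apply (IH2 Z b HZ) |]].
      exact (label_forth X Y Z w a b HX HY HZ (Hmub _ _ _ HR)).
    + intros (a & b & sa & sb & HR).
      destruct (label_back X w a b HX HR) as (Y & Z & HY & HZ & S).
      exists Y, Z. split; [now apply (IH1 Y a HY) | split; [now apply (IH2 Z b HZ) |]].
      auto.
Qed.

End Unravelling.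

(** * The two instances of [R] *)

Lemma is_sup_mub (P : poset) (s t u : P) : is_sup P s t u -> mub P s t u.
Proof.
  intros [ub least]; split; auto.
  intros (x & ubx & xs & ne). apply ne.
  apply (ord_antisym _ _ (le_order P)); auto.
Qed.

Lemma mub_sym (P : poset) (s t u : P) : mub P s t u -> mub P s u t.
Proof.
  intros [[ts us] m]; split; [now split |].
  intros (x & [ux tx] & xs). apply m. exists x; repeat split; auto; apply xs.
Qed.

Lemma is_sup_sym (P : poset) (s t u : P) : is_sup P s t u -> is_sup P s u t.
Proof.
  intros [[ts us] m]; split; [now split |].
  intros x [ux tx]. apply m; now split.
Qed.

Lemma is_sup_refl (P : poset) (s t : P) : le t s -> is_sup P s s t.
Proof.
  intros ts; split; [split; auto; apply (ord_refl _ _ (le_order P)) |].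
  intros x [sx _]; exact sx.
Qed.

Theorem theorem3 (A : Type) : forall phi : form A, MIN phi <-> MIL phi.
Proof.
  intros phi; split; intros H P V s.
  - assert (le_s : forall s t u, is_sup P s t u -> le t s) by (intros ? ? ? [[? _] _]; auto).
    (* Unravel along suprema, then evaluate in [Q] with [mub]; the converse exchanges the roles. *)
    destruct (label_surj P (@is_sup P) s) as [X HX].
    apply (sat_label P _ (@is_sup_sym P) le_s (@is_sup_refl P) A V (@mub _)
             (fun _ _ _ h => h) (@is_sup_mub _) phi X s HX).
    apply H.
  - assert (le_s : forall s t u, mub P s t u -> le t s) by (intros ? ? ? [[? _] _]; auto).
    destruct (label_surj P (@mub P) s) as [X HX].
    apply (sat_label P _ (@mub_sym P) le_s
             (fun s t h => is_sup_mub P s s t (is_sup_refl P s t h)) A V (@is_sup _)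
             (@is_sup_mub _) (fun _ _ _ h => h) phi X s HX).
    apply H.
Qed.
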